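(* Let $A\in\mathbb{R}^{m\times n}$, $\mathbf{b}\in\mathbb{R}^m$, and let $r$ be an integer with $1\le r<\min\{m,n\}$. Let $I\subset\{1,\dots,m\}$ and $J\subset\{1,\dots,n\}$ with $\#(I)=\#(J)=r$ be such that $A_{I,J}$ is nonsingular and has the maximal volume among all $r\times r$ submatrices of $A$. Let $\mathbf{x}_b$ be a least squares solution, i.e. a minimizer of $\|A\mathbf{x}-\mathbf{b}\|_2$ over $\mathbf{x}\in\mathbb{R}^n$, and let $\epsilon=A\mathbf{x}_b-\mathbf{b}$ be its residual vector, split as $\epsilon=[\epsilon_I;\epsilon_{I^c}]$ according to the indices in $I$ and in its complement $I^c$. Let $\hat{\mathbf{x}}\in\mathbb{R}^n$ be the vector whose entries indexed by $J$ are given by $A_{I,J}^{-1}\mathbf{b}_I$ and whose entries indexed by the complement $J^c$ are zero. Then $$\|A\hat{\mathbf{x}}-\mathbf{b}\|_\infty\le \|\epsilon_I\|_1+\frac{(r+1)\,\sigma_{r+1}(A)}{\sqrt{1+\sum_{k=1}^{r}\frac{\sigma_{r+1}^2(A)}{\sigma_k^2(A)}}}\,\|\mathbf{x}_b\|_1+\|\epsilon_{I^c}\|_\infty.$$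
   Context: $A_{I,J}$ is the submatrix of $A$ on rows $I$ and columns $J$; $\mathbf{b}_I$ is the subvector of $\mathbf{b}$ indexed by $I$. The volume of a square matrix is the absolute value of its determinant. $\sigma_1(A)\ge\sigma_2(A)\ge\cdots$ are the singular values of $A$ in decreasing order. *)

(* Defs.v *)
From mathcomp Require Import all_boot all_order all_algebra.
From mathcomp Require Import reals polyrcf.

Set Implicit Arguments.
Unset Strict Implicit.
Unset Printing Implicit Defensive.

Import Order.TTheory GRing.Theory Num.Theory.

Local Open Scope ring_scope.

Section Submatrices.
Variables (R : realType) (m n r : nat).

(* The k-th smallest index (from 0) of a set I of r indices. *)
Definition set_index d (I : {set 'I_d}) (hI : #|I| = r) (k : 'I_r) : 'I_d :=
  enum_val (cast_ord (esym hI) k).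

(* The cardinality proofs make A_{I,J} a square matrix of size r, so that its
   determinant and inverse can be formed. *)
Definition submatrix (I : {set 'I_m}) (J : {set 'I_n}) (hI : #|I| = r)
    (hJ : #|J| = r) (A : 'M[R]_(m, n)) : 'M[R]_r :=
  mxsub (set_index hI) (set_index hJ) A.

Definition subvec (I : {set 'I_m}) (hI : #|I| = r) (v : 'cV[R]_m) : 'cV[R]_r :=
  rowsub (set_index hI) v.

Definition volume (M : 'M[R]_r) : R := `|\det M|.

End Submatrices.

Section Norms.
Variables (R : realType) (d : nat).

Definition norm1 (v : 'cV[R]_d) : R := \sum_i `|v i 0|.

Definition norm2 (v : 'cV[R]_d) : R := Num.sqrt (\sum_i v i 0 ^+ 2).

Definition norm_inf (v : 'cV[R]_d) : R := \big[Num.max/0]_i `|v i 0|.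

End Norms.

Section SingularValues.
Variable R : realType.

(* The real eigenvalues of M, repeated according to their algebraic
   multiplicities; rootsR lists the distinct real roots of a polynomial. *)
Definition real_eigenvalues d (M : 'M[R]_d) : seq R :=
  flatten [seq nseq (mup x (char_poly M)) x | x <- rootsR (char_poly M)].

(* For m < n, A^T A has n - m eigenvalues 0 in excess; they come last in the
   decreasing order. *)
Definition singular_values m n (A : 'M[R]_(m, n)) : seq R :=
  take (minn m n)
    (sort >=%R [seq Num.sqrt x | x <- real_eigenvalues (A^T *m A)]).

(* sigma A k is the k-th largest singular value, with k counted from 1. *)
Definition sigma m n (A : 'M[R]_(m, n)) (k : nat) : R :=
  nth 0 (singular_values A) k.-1.

End SingularValues.

(* Main.v *)
(* For an index i outside I write p for the row A_{i,J} A_{I,J}^{-1}; then the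
   i-th entry of A xhat - b is

     eps_i - p . eps_I - sum_j gamma_ij (xb)_j,
     gamma_ij = A_ij - A_{i,J} A_{I,J}^{-1} A_{I,j},

   and the entries indexed by I vanish.  By Cramer's rule the entries of p are
   ratios of an r x r minor of A to the one of maximal volume, so they are at
   most 1 in absolute value.  If gamma_ij <> 0, the submatrix B of A on the rows
   I + i and the columns J + j is invertible with
   |det B| = |gamma_ij| vol(A_{I,J}), and the entries of B^{-1} are r x r minors
   of A divided by det B, hence at most 1/|gamma_ij|.  Therefore

     sum_k 1/sigma_k(B)^2 = ||B^{-1}||_F^2 <= (r+1)^2/gamma_ij^2,

   and the interlacing sigma_k(B) <= sigma_k(A) turns this into the bound on
   |gamma_ij| in the theorem. *)

Require Import Defs.
From mathcomp Require Import all_boot all_order all_algebra perm.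
From mathcomp Require Import reals polyrcf complex spectral ring.

Set Implicit Arguments.
Unset Strict Implicit.
Unset Printing Implicit Defensive.

Import Order.TTheory GRing.Theory Num.Theory.

Local Open Scope ring_scope.
Local Open Scope sesquilinear_scope.

(** * Real eigenvalues and characteristic polynomials *)

Lemma real_eigenvalues_perm (R : realType) d (M : 'M[R]_d) (s : seq R) :
  char_poly M = \prod_(x <- s) ('X - x%:P) -> perm_eq (real_eigenvalues M) s.
Proof.
move=> chM; rewrite /real_eigenvalues chM.
set p := \prod_(x <- s) _.
have p0 : p != 0 by rewrite monic_neq0 // monic_prod_XsubC.
have mem_roots x : (x \in rootsR p) = (x \in s).
  by rewrite -(roots_on_rootsR p0 x) in_itv /= root_prod_XsubC.
apply/allP => x _ /=; apply/eqP.
(* The root list has no repetitions, so only the block of [x] itself contributes to the count of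
   [x]. *)
rewrite count_flatten -map_comp.
rewrite (eq_map (g := fun y => ((y == x) * count_mem x s)%N)); last first.
  move=> y /=; rewrite count_nseq /= /p mu_prod_XsubC.
  by case: eqVneq => [->|].
have: uniq (rootsR p) by apply: uniq_roots.
case: (boolP (x \in s)) => [xs|xs].
  rewrite -mem_roots in xs.
  move: (rootsR p) xs => t xt ut.
  rewrite sumnE big_map (bigD1_seq x) //= eqxx mul1n big1 ?addn0 // => y /negPf ->.
  by rewrite mul0n.
move=> _; rewrite (count_memPn xs) sumnE big_map big1 // => y _.
by rewrite muln0.
Qed.

Lemma char_poly_conj (F : fieldType) d (P M : 'M[F]_d) :
  P \in unitmx -> char_poly (invmx P *m M *m P) = char_poly M.
Proof.
move=> uP; rewrite /char_poly.
have -> : char_poly_mx (invmx P *m M *m P) =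
    map_mx polyC (invmx P) *m char_poly_mx M *m map_mx polyC P.
  rewrite /char_poly_mx mulmxBr mulmxBl -!map_mxM.
  by rewrite mul_mx_scalar -scalemxAl -map_mxM mulVmx // map_mx1 scalemx1.
rewrite !det_mulmx mulrAC -det_mulmx -map_mxM mulVmx // map_mx1 det1 mul1r //.
Qed.

Lemma char_poly_diag (F : comNzRingType) d (D : 'rV[F]_d) :
  char_poly (diag_mx D) = \prod_i ('X - (D 0 i)%:P).
Proof.
rewrite char_poly_trig ?diag_mx_is_trig //.
by apply: eq_bigr => i _; rewrite mxE eqxx.
Qed.

(* The spectral theorem of MathComp is over numClosedFieldType, hence the detour
   through R[i] for real Gram matrices. *)
Section Complexification.
Variable R : realType.
Notation toC := (real_complex R).

Lemma map_complex_realmx m n (M : 'M[R]_(m, n)) : map_mx toC M \is a mxOver Num.real.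
Proof.
apply/mxOverP => i j; rewrite mxE; apply/complex_realP; by exists (M i j).
Qed.

Lemma map_complex_trC m n (M : 'M[R]_(m, n)) :
  (map_mx toC M)^t* = map_mx toC M^T.
Proof. by rewrite map_trmx realmxC // map_complex_realmx. Qed.

Lemma map_complex_gram_herm m n (A : 'M[R]_(m, n)) :
  map_mx toC (A^T *m A) \is hermsymmx.
Proof.
apply: realsym_hermsym; last exact: map_complex_realmx.
by apply/is_hermitianmxP; rewrite expr0 scale1r map_mx_id // map_trmx trmx_mul trmxK.
Qed.

(** Over [R[i]] the characteristic polynomial splits over the spectral diagonal. Its entries are
    real, so the factorisation descends to [R] by injectivity of the embedding. *)
Lemma map_complex_real_eigenvalues d (M : 'M[R]_d) :
  map_mx toC M \is hermsymmx ->
  perm_eq [seq toC x | x <- real_eigenvalues M]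
          (codom (spectral_diag (map_mx toC M) 0)).
Proof.
move=> hM; set D := spectral_diag _.
have realD := hermitian_spectral_diag_real hM.
have /orthomx_spectralP eM := hermitian_normalmx hM.
have /mxOverP/(_ 0) realDi := realD.
pose s := [seq complex.Re (D 0 i) | i <- enum 'I_d].
have sE : [seq toC x | x <- s] = codom (D 0).
  rewrite /s codomE -map_comp; apply: eq_map => i /=.
  by have /complex_realP [k] := realDi i; rewrite -/D => ->.
rewrite -sE; apply: perm_map; apply: real_eigenvalues_perm.
apply: (map_poly_inj (complex.real_complex R)).
rewrite -/D in eM.
rewrite map_char_poly [in LHS]eM char_poly_conj ?spectral_unit // char_poly_diag.
rewrite rmorph_prod /=.
under [RHS]eq_bigr do rewrite rmorphB /= map_polyX map_polyC /=.
rewrite -(big_map toC xpredT (fun z => 'X - z%:P)) sE codomE big_map.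
by rewrite big_enum.
Qed.

End Complexification.

(** * Hermitian forms and eigenvalue interlacing *)

Lemma mulmx_trC_sum_sqr (C : numClosedFieldType) n (y : 'rV[C]_n) :
  (y *m y^t*) 0 0 = \sum_i `|y 0 i| ^+ 2.
Proof. by rewrite mxE; apply: eq_bigr => i _; rewrite !mxE normCK. Qed.

(** The entries of [w *m P^t*] are the coordinates of [w] in the orthonormal eigenbasis given by the
    rows of [P]. *)
Lemma hermitian_form_spectral (C : numClosedFieldType) n (M : 'M[C]_n)
    (w : 'rV[C]_n) : M \is hermsymmx ->
  (w *m M *m w^t*) 0 0 =
  \sum_i spectral_diag M 0 i * `|(w *m (spectralmx M)^t*) 0 i| ^+ 2.
Proof.
move=> hM; have /orthomx_spectralP eM := hermitian_normalmx hM.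
rewrite {1}eM invmx_unitary ?spectral_unitarymx //.
set P := spectralmx M; set D := spectral_diag M.
have -> : w *m (P^t* *m diag_mx D *m P) *m w^t* =
   (w *m P^t*) *m diag_mx D *m (w *m P^t*)^t*.
  by rewrite trmx_mul map_mxM /= trmxCK !mulmxA.
move: (w *m P^t*) => y; rewrite mxE; apply: eq_bigr => i _.
by rewrite mul_mx_diag !mxE normCK [_ * D 0 i]mulrC mulrA.
Qed.

Lemma unitarymx_norm (C : numClosedFieldType) m n (P : 'M[C]_(m, n)) (w : 'rV[C]_m) :
  P \is unitarymx -> (w *m P) *m (w *m P)^t* = w *m w^t*.
Proof.
by move=> uP; rewrite trmx_mul map_mxM /= mulmxA mulmxtVK.
Qed.

Lemma wide_mx_kernel (F : fieldType) p q (X : 'M[F]_(p, q)) : (q < p)%N ->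
  exists2 c : 'rV_p, c != 0 & c *m X = 0.
Proof.
move=> ltqp; have k0 : kermx X != 0.
  by rewrite -mxrank_eq0 mxrank_ker subn_eq0 -ltnNge (leq_ltn_trans (rank_leq_col _)).
have [i ri] := rowV0Pn k0; exists i => //.
exact/sub_kermxP.
Qed.

(* Courant-Fischer in counting form, which needs no ordering of the eigenvalues:
   otherwise some nonzero w in the span of the eigenvectors of N with eigenvalue
   >= t would be mapped by E to a vector orthogonal to all eigenvectors of M
   with eigenvalue >= t. *)
Lemma spectral_interlacing (C : numClosedFieldType) s n
    (N : 'M[C]_s) (M : 'M[C]_n) (E : 'M[C]_(s, n)) (t : C) :
  N \is hermsymmx -> M \is hermsymmx -> E \is unitarymx -> t \is Num.real ->
  (forall w : 'rV_s, (w *m N *m w^t*) 0 0 <= ((w *m E) *m M *m (w *m E)^t*) 0 0) ->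
  (#|[pred i | (t <= spectral_diag N 0 i)%R]| <= #|[pred i | (t <= spectral_diag M 0 i)%R]|)%N.
Proof.
move=> hN hM uE tR NM.
have uP := spectral_unitarymx N; have uQ := spectral_unitarymx M.
have /mxOverP/(_ 0) pR := hermitian_spectral_diag_real hN.
have /mxOverP/(_ 0) dR := hermitian_spectral_diag_real hM.
rewrite leqNgt; apply/negP.
set L := [pred i | _ <= _]; set K := [pred i | _ <= _] => ltLK.
set P := spectralmx N in uP; set Q := spectralmx M in uQ.
set p := spectral_diag N in pR K ltLK *; set d := spectral_diag M in dR L ltLK *.
(* [K] and [L] index the eigenvalues at least [t] of [N] and of [M]. [X] has [#|K|] rows and fewer
   columns, so some [c != 0] kills it; [w] and [z] are the vectors of the contradiction. *)
pose PK := rowsub (@enum_val _ K) P.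
pose X := colsub (@enum_val _ L) (PK *m E *m Q^t*).
have [c c0 cX] := wide_mx_kernel X ltLK.
pose w := c *m PK; pose z := w *m E *m Q^t*.
have uPK : PK \is unitarymx.
  apply/row_unitarymxP => i j; rewrite !row_rowsub (row_unitarymxP uP).
  by rewrite (inj_eq enum_val_inj).
have uQt : Q^t* \is unitarymx by rewrite trmxC_unitary.
have nw : w *m w^t* = c *m c^t* by rewrite unitarymx_norm.
have nz : z *m z^t* = w *m w^t* by rewrite !unitarymx_norm.
have cXz : c *m X = colsub (@enum_val _ L) z by rewrite mulmx_colsub !mulmxA.
have zL i : L i -> z 0 i = 0.
  move=> Li; move/rowP: cX => /(_ (enum_rank_in Li i)).
  by rewrite cXz !mxE enum_rankK_in.
have nwy : w *m w^t* = (w *m P^t*) *m (w *m P^t*)^t*.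
  by rewrite [RHS]unitarymx_norm // trmxC_unitary.
have wK i : ~~ K i -> (w *m P^t*) 0 i = 0.
  move=> Ki; rewrite /w -mulmxA /PK mul_rowsub_mx (unitarymxP uP) mxE big1 // => k _.
  rewrite !mxE; case: eqP => [ki|_]; last by rewrite mulr0.
  by case/negP: Ki; rewrite -ki; exact: (enum_valP k).
(* [w] has components only along eigenvalues of [N] that are at least [t], and [z] only along those
   of [M] below [t]. Hence the terms [(d_i - t) |z_i|^2] are nonpositive with a nonnegative sum. All
   vanish, so [z = 0], and [c = 0] because norms are preserved. *)
have low : t * (w *m w^t*) 0 0 <= (w *m N *m w^t*) 0 0.
  rewrite hermitian_form_spectral // nwy mulmx_trC_sum_sqr mulr_sumr.
  apply: ler_sum => i _; case: (boolP (K i)) => [Ki|/wK ->].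
    by rewrite ler_wpM2r // exprn_ge0.
  by rewrite normr0 expr0n /= !mulr0.
have := le_trans low (NM w); rewrite -nz hermitian_form_spectral //.
rewrite -/d -/z mulmx_trC_sum_sqr mulr_sumr -subr_ge0 -sumrB.
have terms i : d 0 i * `|z 0 i| ^+ 2 - t * `|z 0 i| ^+ 2 <= 0.
  case: (boolP (L i)) => [/zL ->|]; first by rewrite normr0 expr0n /= !mulr0 subrr.
  rewrite /L /= -real_ltNge // => lt_dt.
  by rewrite -mulrBl mulr_le0_ge0 ?exprn_ge0 // subr_le0 ltW.
move=> ge0.
have : \sum_i (t * `|z 0 i| ^+ 2 - d 0 i * `|z 0 i| ^+ 2) == 0.
  rewrite eq_le sumr_ge0 ?andbT; last by move=> i _; rewrite -oppr_le0 opprB.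
  by rewrite -oppr_ge0 -sumrN; under eq_bigr do rewrite opprB.
rewrite psumr_eq0 => [/allP zterms|i _]; last by rewrite -oppr_le0 opprB.
have z0 : z = 0.
  apply/rowP => i; rewrite [RHS]mxE.
  case: (boolP (L i)) => [/zL //|].
  rewrite /L /= -real_ltNge // => lt_dt.
  have := zterms i (mem_index_enum _); rewrite /= -mulrBl mulf_eq0 subr_eq0.
  by rewrite gt_eqF //= expf_eq0 /= normr_eq0 => /eqP.
move: c0; apply/negP; rewrite negbK.
have := mulmx_trC_sum_sqr c; rewrite -nw -nz z0 mul0mx [LHS]mxE => /esym/eqP.
rewrite psumr_eq0 => [/allP cz|i _]; last exact: exprn_ge0.
apply/eqP/rowP => i; rewrite [RHS]mxE; apply/eqP.
by have := cz i (mem_index_enum _); rewrite /= expf_eq0 /= normr_eq0.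
Qed.

(** Take as threshold the entry of index [k] in [s1]: at least [k + 1] entries of [s1] reach it,
    while at most [k] entries of [s2] could if its own entry of index [k] were smaller. *)
Lemma sorted_ge_nth_le (R : realDomainType) (s1 s2 : seq R) k :
  sorted >=%R s1 -> sorted >=%R s2 -> (k < size s1)%N ->
  (forall t, (count (fun x : R => t <= x)%R s1 <= count (fun x : R => t <= x)%R s2)%N) ->
  nth 0 s1 k <= nth 0 s2 k.
Proof.
move=> so1 so2 k1 /(_ (nth 0 s1 k)); set t := nth 0 s1 k => cnt.
have le_t : (k < count (fun x : R => (t <= x)%R) s1)%N.
  rewrite -(cat_take_drop k.+1 s1) count_cat.
  apply: leq_trans (leq_addr _ _).
  suff /eqP -> : count (fun x : R => t <= x)%R (take k.+1 s1) == size (take k.+1 s1)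
    by rewrite size_take_min (minn_idPl k1).
  rewrite -all_count.
  apply/(all_nthP 0) => i; rewrite size_take_min (minn_idPl k1) ltnS => ik.
  rewrite nth_take // /t.
  by apply: (sorted_leq_nth ge_trans ge_refl) => //; rewrite inE ?(leq_ltn_trans ik).
have := leq_trans le_t cnt; rewrite ltnNge => /negP nle.
rewrite leNgt; apply/negP => lt_t; apply: nle.
rewrite -(cat_take_drop k s2) count_cat.
have -> : count (fun x : R => t <= x)%R (drop k s2) = 0%N.
  apply/eqP; rewrite -leqn0 leqNgt -has_count; apply/(has_nthP 0) => -[j].
  rewrite size_drop nth_drop => iS; apply/negP; rewrite -ltNge.
  apply: le_lt_trans lt_t.
  have ki : (k + j < size s2)%N by rewrite -ltn_subRL.
  apply: (sorted_leq_nth ge_trans ge_refl) => //; rewrite ?inE ?leq_addr //.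
  exact: leq_ltn_trans (leq_addr _ _) ki.
by rewrite addn0 (leq_trans (count_size _ _)) // size_take_min geq_minl.
Qed.

(** * Gram matrices and singular values *)

Section Gram.
Variable R : realType.
Notation toC := (real_complex R).

Lemma sum_inj_le s m (f : 'I_s -> 'I_m) (F : 'I_m -> R[i]) :
  injective f -> (forall i, 0 <= F i) -> \sum_k F (f k) <= \sum_i F i.
Proof.
move=> injf F0.
have -> : \sum_k F (f k) = \sum_(i in f @: setT) F i.
  by rewrite big_imset /= => [|? ? _ _ /injf //]; apply: eq_bigl => k; rewrite inE.
by rewrite [leRHS](bigID [in f @: setT]) /= lerDl sumr_ge0.
Qed.

Lemma size_gram_eigenvalues m n (A : 'M[R]_(m, n)) :
  size (real_eigenvalues (A^T *m A)) = n.
Proof.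
have /perm_size := map_complex_real_eigenvalues (map_complex_gram_herm A).
by rewrite size_map size_codom card_ord.
Qed.

Lemma count_gram_eigenvalues m n (A : 'M[R]_(m, n)) t :
  count (fun x : R => t <= x)%R (real_eigenvalues (A^T *m A)) =
  #|[pred i | toC t <= spectral_diag (map_mx toC (A^T *m A)) 0 i]%R|.
Proof.
have /seq.permP/(_ (fun z => toC t <= z)) := map_complex_real_eigenvalues (map_complex_gram_herm A).
rewrite count_map codomE count_map /= => cnt.
rewrite cardE size_filter -enumT -cnt.
by apply: eq_count => x /=; rewrite lecR.
Qed.

(** The selection matrix [G] extends a vector by zeros outside the columns [g]. The two Gram forms
    are then sums of squares of the same entries, over the rows [f] only and over all rows. *)
Lemma gram_eigenvalues_interlacing m n p s (A : 'M[R]_(m, n))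
    (f : 'I_p -> 'I_m) (g : 'I_s -> 'I_n) k :
  injective f -> injective g -> (k < s)%N ->
  nth 0 (sort >=%R (real_eigenvalues ((mxsub f g A)^T *m mxsub f g A))) k <=
  nth 0 (sort >=%R (real_eigenvalues (A^T *m A))) k.
Proof.
move=> injf injg ks.
apply: sorted_ge_nth_le; rewrite ?size_sort ?size_gram_eigenvalues //;
  try exact: (sort_sorted ge_total).
move=> t.
rewrite (seq.permP (permEl (perm_sort _ _))) (seq.permP (permEl (perm_sort _ _))).
rewrite !count_gram_eigenvalues.
pose G : 'M[R]_(s, n) := rowsub g 1%:M.
apply: (@spectral_interlacing _ _ _ _ _ (map_mx toC G)); rewrite ?map_complex_gram_herm //.
- apply/unitarymxP; rewrite map_complex_trC -map_mxM -(map_mx1 toC); congr map_mx.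
  rewrite mul_rowsub_mx mul1mx; apply/matrixP => i j; rewrite !mxE.
  by rewrite (inj_eq injg) eq_sym.
- by apply/complex_realP; exists t.
move=> w.
have gramE q r (X : 'M[R]_(q, r)) (v : 'rV_r) :
    (v *m map_mx toC (X^T *m X) *m v^t*) 0 0 = \sum_i `|(v *m map_mx toC X^T) 0 i| ^+ 2.
  rewrite -mulmx_trC_sum_sqr trmx_mul !map_mxM /= map_complex_trC trmxK.
  by rewrite !mulmxA.
rewrite !gramE.
rewrite (eq_bigr (fun i => `|(w *m map_mx toC G *m map_mx toC A^T) 0 (f i)| ^+ 2)).
  apply: (sum_inj_le (F := fun i => `|(w *m map_mx toC G *m map_mx toC A^T) 0 i| ^+ 2)) => // i.
  by rewrite exprn_ge0.
move=> i _; rewrite -mulmxA -map_mxM /G mul_rowsub_mx mul1mx !mxE.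
by congr (`|_| ^+ 2); apply: eq_bigr => j _; rewrite !mxE.
Qed.

Lemma real_eigenvalues_eigenvalue d (M : 'M[R]_d) x :
  x \in real_eigenvalues M -> eigenvalue M x.
Proof.
case/flattenP => s /mapP[y yr ->]; rewrite mem_nseq => /andP[_ /eqP ->].
have p0 : char_poly M != 0 by rewrite monic_neq0 // char_poly_monic.
by rewrite eigenvalue_root_char; have := roots_on_rootsR p0 y; rewrite yr in_itv.
Qed.

Lemma sum_sqr_gt0 d (v : 'rV[R]_d) : v != 0 -> 0 < (v *m v^T) 0 0.
Proof.
move=> v0; rewrite mxE lt_def sumr_ge0 => [|i _]; last by rewrite mxE -expr2 sqr_ge0.
rewrite andbT; apply: contra v0; rewrite psumr_eq0 => [/allP v0|i _]; last first.
  by rewrite mxE -expr2 sqr_ge0.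
apply/eqP/rowP => i; rewrite [RHS]mxE.
by have := v0 i (mem_index_enum _); rewrite /= mxE mulf_eq0 orbb => /eqP.
Qed.

(** For an eigenvector [v], [x |v|^2 = |v *m B^T|^2], and the right side is positive since [B] is
    invertible. *)
Lemma gram_eigenvalues_gt0 d (B : 'M[R]_d) x :
  B \in unitmx -> x \in real_eigenvalues (B^T *m B) -> 0 < x.
Proof.
move=> uB /real_eigenvalues_eigenvalue /eigenvalueP[v vB v0].
have uBt : B^T \in unitmx by rewrite unitmx_tr.
have vB0 : v *m B^T != 0.
  by apply: contra v0 => /eqP vB0; rewrite -(mulmxK uBt v) vB0 mul0mx.
have := sum_sqr_gt0 vB0; rewrite trmx_mul trmxK mulmxA -(mulmxA v) vB.
by rewrite -scalemxAl mxE pmulr_lgt0 ?sum_sqr_gt0.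
Qed.

(** Both sides are the trace of the inverse of [B^T *m B]: inverting the spectral diagonal inverts
    the matrix, and the trace ignores conjugation by [P]. *)
Lemma sum_inv_gram_eigenvalues d (B : 'M[R]_d) : B \in unitmx ->
  \sum_(x <- real_eigenvalues (B^T *m B)) x^-1 = \sum_i \sum_j (invmx B i j) ^+ 2.
Proof.
move=> uB; have hN := map_complex_gram_herm B.
have pe := map_complex_real_eigenvalues hN.
set N := map_mx _ _ in hN pe; pose P := spectralmx N; set D := spectral_diag N in pe.
have D0 i : D 0 i != 0.
  have : D 0 i \in codom (D 0) by apply: codom_f.
  rewrite -(perm_mem pe) => /mapP[x xe ->].
  by rewrite fmorph_eq0 gt_eqF // (gram_eigenvalues_gt0 uB).
apply: (fmorph_inj toC).
rewrite rmorph_sum /=; under eq_bigr do rewrite fmorphV.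
rewrite -(big_map toC xpredT (fun z => z^-1)) (perm_big _ pe) /= codomE big_map.
have -> : \sum_i \sum_j invmx B i j ^+ 2 = \tr (invmx B *m (invmx B)^T).
  by apply: eq_bigr => i _; rewrite mxE; apply: eq_bigr => j _; rewrite mxE expr2.
rewrite -trace_map_mx.
have uP : P \in unitmx by exact: spectral_unit.
have eN : N = invmx P *m diag_mx D *m P by exact/orthomx_spectralP/hermitian_normalmx.
pose Dv : 'rV_d := \row_i (D 0 i)^-1.
have NV : (invmx P *m diag_mx Dv *m P) *m N = 1%:M.
  rewrite eN !mulmxA mulmxK // -(mulmxA (invmx P)) mulmx_diag.
  rewrite (_ : \row_j _ = const_mx 1) ?diag_const_mx ?mulmx1 ?mulVmx //.
  by apply/rowP => i; rewrite !mxE mulVf.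
have NI : N *m map_mx toC (invmx B *m (invmx B)^T) = 1%:M.
  rewrite -map_mxM mulmxA mulmxK // -trmx_mul mulVmx // trmx1; exact: map_mx1.
have -> : map_mx toC (invmx B *m (invmx B)^T) = invmx P *m diag_mx Dv *m P.
  by rewrite -[LHS]mul1mx -NV -[LHS]mulmxA NI mulmx1.
rewrite mxtrace_mulC mulKVmx //.
by rewrite mxtrace_diag big_enum; apply: eq_bigr => i _; rewrite mxE.
Qed.

Lemma sigma_sqr m n (A : 'M[R]_(m, n)) k : (k < minn m n)%N ->
  0 <= nth 0 (sort >=%R (real_eigenvalues (A^T *m A))) k ->
  sigma A k.+1 ^+ 2 = nth 0 (sort >=%R (real_eigenvalues (A^T *m A))) k.
Proof.
move=> kmn; rewrite /sigma /singular_values nth_take //=.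
set s := real_eigenvalues _.
(* The square root is monotone, so it commutes with sorting. *)
have -> : sort >=%R [seq Num.sqrt x | x <- s] = [seq Num.sqrt x | x <- sort >=%R s].
  apply: (sorted_eq ge_trans ge_anti); first exact: (sort_sorted ge_total).
    apply: (homo_sorted (e := >=%R)) => [x y /=|]; first exact: ler_wsqrtr.
    exact: (sort_sorted ge_total).
  by rewrite perm_sort perm_sym perm_map // perm_sort.
rewrite (nth_map 0) ?size_sort ?size_gram_eigenvalues ?(leq_trans kmn) ?geq_minr //.
exact: sqr_sqrtr.
Qed.

Lemma sigma_ge0 m n (A : 'M[R]_(m, n)) k : 0 <= sigma A k.
Proof.
rewrite /sigma; case: (ltnP k.-1 (size (singular_values A))) => [kl|/(nth_default 0) -> //].
have /mem_take := mem_nth 0 kl.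
by rewrite mem_sort => /mapP[x _ ->]; apply: sqrtr_ge0.
Qed.

End Gram.

(** * Maximal volume and determinant identities *)

Section MaximalVolume.
Variables (R : realType) (m n r : nat) (A : 'M[R]_(m, n)).

Lemma set_index_inj d (K : {set 'I_d}) (hK : #|K| = r) : injective (set_index hK).
Proof. by move=> k l /enum_val_inj /cast_ord_inj. Qed.

Lemma set_index_in d (K : {set 'I_d}) (hK : #|K| = r) k : set_index hK k \in K.
Proof. exact: enum_valP. Qed.

Lemma set_indexP d (K : {set 'I_d}) (hK : #|K| = r) i :
  i \in K -> exists k, i = set_index hK k.
Proof.
move=> iK; exists (cast_ord hK (enum_rank_in iK i)).
by rewrite /set_index cast_ordK enum_rankK_in.
Qed.

(** Maximality is assumed for index sets, but the minors met below may list their rows and columns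
    in any order. The permutation [s] restores the increasing order and changes a determinant only
    by a sign. *)
Lemma inj_set_index_perm d (f : 'I_r -> 'I_d) : injective f ->
  exists (K : {set 'I_d}) (hK : #|K| = r) (s : 'S_r), f =1 set_index hK \o s.
Proof.
move=> injf; have hK : #|f @: setT| = r by rewrite card_imset // cardsT card_ord.
pose h k : 'I_r := cast_ord hK (enum_rank_in (imset_f f (in_setT k)) (f k)).
have hE k : set_index hK (h k) = f k.
  by rewrite /set_index cast_ordK enum_rankK_in // imset_f.
have injh : injective h by move=> k l hkl; apply: injf; rewrite -!hE hkl.
by exists (f @: setT), hK, (perm injh) => k /=; rewrite permE hE.
Qed.

Lemma det_mxsub_max (V : R) (f : 'I_r -> 'I_m) (g : 'I_r -> 'I_n) :
  (forall (I : {set 'I_m}) (J : {set 'I_n}) (hI : #|I| = r) (hJ : #|J| = r),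
     volume (submatrix hI hJ A) <= V) ->
  injective f -> injective g -> `|\det (mxsub f g A)| <= V.
Proof.
move=> maxV /inj_set_index_perm[I [hI [s fE]]] /inj_set_index_perm[J [hJ [t gE]]].
have -> : mxsub f g A = perm_mx s *m submatrix hI hJ A *m (perm_mx t)^T.
  rewrite tr_perm_mx -col_permE -row_permE.
  by apply/matrixP => i j; rewrite !mxE fE gE.
rewrite !det_mulmx det_tr !det_perm !normrM !normrX normrN1 !expr1n mul1r mulr1.
exact: maxV.
Qed.

End MaximalVolume.

(** Replacing row [k] by [u] leaves the cofactors of that row unchanged, and these form column [k]
    of the adjugate. *)
Lemma mulmx_invmx_Cramer (F : fieldType) r (M : 'M[F]_r) (u : 'rV_r) k :
  M \in unitmx ->
  (u *m invmx M) 0 k = (\det M)^-1 * \det (\matrix_(i, j) if i == k then u 0 j else M i j).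
Proof.
move=> uM; rewrite /invmx uM -scalemxAr mxE; congr (_ * _).
rewrite (expand_det_row _ k) mxE; apply: eq_bigr => l _.
rewrite !mxE eqxx; congr (_ * _); rewrite /cofactor; congr (_ * \det _).
by apply/matrixP => i j; rewrite !mxE eq_sym (negPf (neq_lift _ _)).
Qed.

(** Block elimination: a unipotent right factor splits off the Schur complement of [M]. *)
Lemma det_bordered (F : fieldType) r (a : 'M[F]_1) (u : 'rV[F]_r) (v : 'cV[F]_r) (M : 'M[F]_r) :
  M \in unitmx ->
  \det (block_mx a u v M) = \det M * (a - u *m invmx M *m v) 0 0.
Proof.
move=> uM.
have -> : block_mx a u v M =
    block_mx (a - u *m invmx M *m v) u 0 M *m block_mx 1%:M 0 (invmx M *m v) 1%:M.
  rewrite mulmx_block !mulmx1 !mulmx0 !add0r.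
  by rewrite mulmxA subrK mulmxA mulmxV // mul1mx.
by rewrite det_mulmx det_ublock det_lblock !det1 !mulr1 det_mx11 mulrC.
Qed.

(** * Entries of the Schur complement *)

Section SkeletonError.
Variables (R : realType) (m n r : nat) (A : 'M[R]_(m, n)).

(** The coefficient of [norm1 xb] in the theorem. *)
Definition skeleton_bound : R :=
  (r.+1%:R * sigma A r.+1)
  / Num.sqrt (1 + \sum_(1 <= k < r.+1) sigma A r.+1 ^+ 2 / sigma A k ^+ 2).

Lemma skeleton_bound_ge0 : 0 <= skeleton_bound.
Proof. by rewrite divr_ge0 ?mulr_ge0 ?sqrtr_ge0 ?sigma_ge0. Qed.

Lemma skeleton_bound_ge (f : 'I_r.+1 -> 'I_m) (g : 'I_r.+1 -> 'I_n) (c : R) :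
  (r < minn m n)%N -> injective f -> injective g -> 0 < c ->
  mxsub f g A \in unitmx ->
  (forall k l, `|invmx (mxsub f g A) k l| <= c^-1) -> c <= skeleton_bound.
Proof.
move=> rmn injf injg c0; set B := mxsub f g A => uB cB.
(* Squared singular values of [A] and of [B], indexed from 0. Invertibility makes [mu] positive, and
   interlacing passes this on to [lam], so all divisions by the first [r + 1] of them are
   genuine. *)
pose lam := nth 0 (sort >=%R (real_eigenvalues (A^T *m A))).
pose mu := nth 0 (sort >=%R (real_eigenvalues (B^T *m B))).
have mu_gt0 k : (k < r.+1)%N -> 0 < mu k.
  move=> kr; apply: (gram_eigenvalues_gt0 uB).
  by rewrite -(mem_sort >=%R) mem_nth // size_sort size_gram_eigenvalues.
have mu_lam k : (k < r.+1)%N -> mu k <= lam k.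
  by move=> kr; apply: gram_eigenvalues_interlacing.
have lam_gt0 k : (k < r.+1)%N -> 0 < lam k.
  by move=> kr; apply: lt_le_trans (mu_lam k kr); apply: mu_gt0.
have sigE k : (k < r.+1)%N -> sigma A k.+1 ^+ 2 = lam k.
  move=> kr; apply: sigma_sqr; first exact: leq_trans kr rmn.
  exact: ltW (lam_gt0 k kr).
pose T := \sum_(k < r.+1) (lam k)^-1.
have T_gt0 : 0 < T.
  rewrite /T big_ord_recr /= ltr_wpDl ?invr_gt0 ?lam_gt0 //.
  by apply: sumr_ge0 => k _; rewrite invr_ge0 ltW // lam_gt0 // ltnS ltnW.
have sig_gt0 : 0 < sigma A r.+1.
  by rewrite lt_def sigma_ge0 andbT -sqrf_eq0 sigE // gt_eqF // lam_gt0.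
have T_le : T <= r.+1%:R ^+ 2 * c^-1 ^+ 2.
  apply: (@le_trans _ _ (\sum_(x <- real_eigenvalues (B^T *m B)) x^-1)).
    rewrite -(perm_big _ (permEl (perm_sort >=%R _))) /= (big_nth 0) size_sort.
    rewrite size_gram_eigenvalues big_mkord /T; apply: ler_sum => k _.
    by rewrite lef_pV2 ?posrE ?mu_lam ?mu_gt0 ?lam_gt0.
  rewrite sum_inv_gram_eigenvalues //.
  apply: (@le_trans _ _ (\sum_(i < r.+1) \sum_(j < r.+1) c^-1 ^+ 2)).
    apply: ler_sum => i _; apply: ler_sum => j _.
    by rewrite -real_normK ?num_real // ler_sqr ?nnegrE ?invr_ge0 ?(ltW c0).
  by rewrite !sumr_const !card_ord -mulrnA -[leLHS]mulr_natl natrM expr2.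
(* The last term of [T] supplies the leading 1. The bound thus simplifies to [r.+1%:R / Num.sqrt T],
   which [T_le] compares with [c]. *)
have denE : 1 + \sum_(1 <= k < r.+1) sigma A r.+1 ^+ 2 / sigma A k ^+ 2 =
    sigma A r.+1 ^+ 2 * T.
  rewrite big_add1 big_mkord /T big_ord_recr /= mulrDr addrC mulr_sumr sigE //.
  rewrite divff ?gt_eqF ?lam_gt0 //; congr (_ + _); apply: eq_bigr => k _.
  by rewrite sigE // ltnS ltnW.
rewrite /skeleton_bound denE sqrtrM ?exprn_ge0 ?sigma_ge0 // sqrtr_sqr gtr0_norm //.
rewrite [sigma A _ * Num.sqrt T]mulrC -mulf_div divff ?gt_eqF // mulr1.
rewrite ler_pdivlMr ?sqrtr_gt0 // mulrC -ler_pdivlMr //.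
rewrite -[leRHS]ger0_norm; last by rewrite divr_ge0 // ltW.
by rewrite -sqrtr_sqr ler_wsqrtr // expr_div_n -exprVn.
Qed.

End SkeletonError.

(** The new index comes first, so that a bordered submatrix is a [block_mx] with a scalar upper left
    block. *)
Definition border (d r : nat) (i : 'I_d) (f : 'I_r -> 'I_d) (k : 'I_(1 + r)) : 'I_d :=
  match split k with inl _ => i | inr l => f l end.

Lemma border_inj d r (i : 'I_d) (f : 'I_r -> 'I_d) :
  injective f -> (forall k, f k != i) -> injective (border i f).
Proof.
move=> injf fi k l; rewrite -[k]splitK -[l]splitK /border !unsplitK.
case: (split k) => k'; case: (split l) => l' //=.
- by rewrite !ord1.
- by move=> /esym /eqP; rewrite (negPf (fi _)).
- by move=> /eqP; rewrite (negPf (fi _)).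
- by move=> /injf ->.
Qed.

Lemma mxsub_border (T : Type) m n r (A : 'M[T]_(m, n))
    (f : 'I_r -> 'I_m) (g : 'I_r -> 'I_n) i j :
  mxsub (border i f) (border j g) A =
  block_mx (const_mx (A i j)) (row i (colsub g A)) (col j (rowsub f A)) (mxsub f g A).
Proof.
apply/matrixP => k l; rewrite -[k]splitK -[l]splitK !mxE /border !unsplitK.
by case: (split k) => k' /=; rewrite !mxE unsplitK; case: (split l) => l' /=; rewrite !mxE.
Qed.

Lemma invmx_entry_le (F : numFieldType) r (B : 'M[F]_r.+1) V k l :
  (forall i j, `|\det (row' i (col' j B))| <= V) -> B \in unitmx ->
  `|invmx B k l| <= V / `|\det B|.
Proof.
move=> minors uB; rewrite /invmx uB !mxE normrM normfV mulrC ler_wpM2r ?invr_ge0 //.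
by rewrite /cofactor normrM normrX normrN1 expr1n mul1r.
Qed.

(** The [gamma_ij]: an entry of [A] minus its skeleton approximation from the rows [f] and columns
    [g]. *)
Definition schur_entry (F : fieldType) m n r (A : 'M[F]_(m, n))
    (f : 'I_r -> 'I_m) (g : 'I_r -> 'I_n) i j : F :=
  A i j - (row i (colsub g A) *m invmx (mxsub f g A) *m col j (rowsub f A)) 0 0.

(** This settles the columns in [J], where bordering would repeat a column. *)
Lemma schur_entry_col (F : fieldType) m n r (A : 'M[F]_(m, n))
    (f : 'I_r -> 'I_m) (g : 'I_r -> 'I_n) i l :
  mxsub f g A \in unitmx -> schur_entry A f g i (g l) = 0.
Proof.
move=> uM; rewrite /schur_entry.
have -> : col (g l) (rowsub f A) = col l (mxsub f g A).
  by apply/colP => k; rewrite !mxE.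
by rewrite [col l _]colE mulmxA mulmxKV // -colE !mxE subrr.
Qed.

Lemma schur_entry_le (R : realType) m n r (A : 'M[R]_(m, n))
    (f : 'I_r -> 'I_m) (g : 'I_r -> 'I_n) i j :
  (r < minn m n)%N -> injective f -> injective g ->
  (forall k, f k != i) -> (forall k, g k != j) ->
  mxsub f g A \in unitmx ->
  (forall (f' : 'I_r -> 'I_m) (g' : 'I_r -> 'I_n), injective f' -> injective g' ->
     `|\det (mxsub f' g' A)| <= `|\det (mxsub f g A)|) ->
  `|schur_entry A f g i j| <= skeleton_bound r A.
Proof.
move=> rmn injf injg fi gj uM maxM.
have [->|s0] := eqVneq (schur_entry A f g i j) 0.
  by rewrite normr0 skeleton_bound_ge0.
pose f' : 'I_r.+1 -> 'I_m := border i f; pose g' : 'I_r.+1 -> 'I_n := border j g.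
have injf' : injective f' by apply: border_inj.
have injg' : injective g' by apply: border_inj.
pose B : 'M_r.+1 := mxsub f' g' A.
have detB : \det B = \det (mxsub f g A) * schur_entry A f g i j.
  by rewrite [B]mxsub_border det_bordered // /schur_entry !mxE.
have detM0 : \det (mxsub f g A) != 0 by rewrite -unitfE -unitmxE.
have uB : B \in unitmx by rewrite unitmxE unitfE detB mulf_neq0.
(* Here [c] is the absolute value of the Schur entry. The minors of [B] are [r] by [r] minors of
   [A], and dividing the maximal one by [|det B|] gives exactly [c^-1]. *)
apply: (@skeleton_bound_ge _ _ _ _ _ f' g') => //; first by rewrite normr_gt0.
move=> k l; apply: le_trans (invmx_entry_le _ _ _ uB) _.
  move=> i' j'; have -> : row' i' (col' j' B) = mxsub (f' \o lift i') (g' \o lift j') A.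
    by apply/matrixP => a b; rewrite !mxE.
  by apply: maxM; apply: inj_comp => //; apply: lift_inj.
by rewrite detB normrM invfM mulrA divff ?mul1r ?normr_eq0.
Qed.

Lemma maxvol_coef_le1 (R : realType) m n r (A : 'M[R]_(m, n))
    (f : 'I_r -> 'I_m) (g : 'I_r -> 'I_n) i k :
  injective f -> injective g -> (forall l, f l != i) ->
  mxsub f g A \in unitmx ->
  (forall (f' : 'I_r -> 'I_m) (g' : 'I_r -> 'I_n), injective f' -> injective g' ->
     `|\det (mxsub f' g' A)| <= `|\det (mxsub f g A)|) ->
  `|(row i (colsub g A) *m invmx (mxsub f g A)) 0 k| <= 1.
Proof.
move=> injf injg fi uM maxM; rewrite mulmx_invmx_Cramer //.
(* The numerator in Cramer's rule is the minor with the row [f k] exchanged for [i]; since [i] is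
   not a value of [f], [f'] stays injective. *)
pose f' a := if a == k then i else f a.
have -> : \matrix_(a, b) (if a == k then row i (colsub g A) 0 b else mxsub f g A a b)
    = mxsub f' g A.
  by apply/matrixP => a b; rewrite !mxE /f'; case: (a == k).
have M0 : 0 < `|\det (mxsub f g A)| by rewrite normr_gt0 -unitfE -unitmxE.
rewrite normrM normfV mulrC ler_pdivrMr // mul1r; apply: maxM => // a b; rewrite /f'.
case: (eqVneq a k) => [->|_]; case: (eqVneq b k) => [->|_] // E; last exact: injf.
  by have := fi b; rewrite -E eqxx.
by have := fi a; rewrite E eqxx.
Qed.

(** * The error estimate *)

Lemma mulmx_support (F : pzRingType) m n p r (A : 'M[F]_(m, n)) (x : 'M[F]_(n, p))
    (J : {set 'I_n}) (hJ : #|J| = r) :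
  (forall j, j \notin J -> row j x = 0) ->
  A *m x = colsub (set_index hJ) A *m rowsub (set_index hJ) x.
Proof.
move=> xJ; apply/matrixP => i k; rewrite !mxE.
rewrite (bigID [in J]) /= [X in _ + X]big1 ?addr0 => [|j /xJ /rowP/(_ k)]; last first.
  by rewrite !mxE => ->; rewrite mulr0.
have JE : J = set_index hJ @: setT.
  apply/setP => j; apply/idP/imsetP => [jJ|[l _ ->]]; last exact: set_index_in.
  by have [l ->] := set_indexP hJ jJ; exists l.
rewrite [in LHS]JE big_imset /= => [|? ? _ _ /set_index_inj //].
by apply: eq_big => l; rewrite ?inE ?mxE.
Qed.

Lemma le_norm_inf (R : realType) d (v : 'cV[R]_d) i : `|v i 0| <= norm_inf v.
Proof. exact: le_bigmax. Qed.

Theorem theorem7 (R : realType) (m n r : nat)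
    (A : 'M[R]_(m, n)) (b : 'cV[R]_m)
    (r_ge1 : (1 <= r)%N) (r_lt : (r < minn m n)%N)
    (I : {set 'I_m}) (J : {set 'I_n}) (hI : #|I| = r) (hJ : #|J| = r)
    (nonsing : submatrix hI hJ A \in unitmx)
    (maxvol : forall (I' : {set 'I_m}) (J' : {set 'I_n})
                (hI' : #|I'| = r) (hJ' : #|J'| = r),
       volume (submatrix hI' hJ' A) <= volume (submatrix hI hJ A))
    (xb : 'cV[R]_n)
    (least_squares : forall x : 'cV[R]_n,
       norm2 (A *m xb - b) <= norm2 (A *m x - b))
    (eps : 'cV[R]_m) (eps_def : eps = A *m xb - b)
    (xhat : 'cV[R]_n)
    (xhat_in : subvec hJ xhat = invmx (submatrix hI hJ A) *m subvec hI b)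
    (xhat_out : forall j : 'I_n, j \notin J -> xhat j 0 = 0) :
  norm_inf (A *m xhat - b) <=
    norm1 (subvec hI eps)
    + (r.+1%:R * sigma A r.+1)
      / Num.sqrt (1 + \sum_(1 <= k < r.+1) sigma A r.+1 ^+ 2 / sigma A k ^+ 2)
      * norm1 xb
    + norm_inf (subvec (erefl #|~: I|) eps).
Proof.
rewrite -/(skeleton_bound r A).
set f := set_index hI; set g := set_index hJ.
have injf : injective f by exact: set_index_inj.
have injg : injective g by exact: set_index_inj.
have maxM (f' : 'I_r -> 'I_m) (g' : 'I_r -> 'I_n) : injective f' -> injective g' ->
    `|\det (mxsub f' g' A)| <= `|\det (mxsub f g A)|.
  exact: (det_mxsub_max maxvol).
rewrite /submatrix -/f -/g in nonsing xhat_in.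
have norm1_ge0 d (v : 'cV[R]_d) : 0 <= norm1 v by apply: sumr_ge0.
have norm_inf_ge0 d (v : 'cV[R]_d) : 0 <= norm_inf v by exact: bigmax_ge_id.
have rhs1_ge0 : 0 <= norm1 (subvec hI eps) + skeleton_bound r A * norm1 xb.
  by apply: addr_ge0 => //; apply: mulr_ge0 => //; apply: skeleton_bound_ge0.
(* The maximum in [norm_inf] starts from 0, so the bound itself must be shown nonnegative. *)
apply: bigmax_le => [|i _]; first exact: addr_ge0.
have Axhat : A *m xhat = colsub g A *m invmx (mxsub f g A) *m subvec hI b.
  rewrite (mulmx_support _ hJ) => [|j jJ]; last by apply/rowP => k; rewrite !mxE ord1 xhat_out.
  by rewrite -[rowsub _ xhat]/(subvec hJ xhat) xhat_in mulmxA.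
pose p := row i (colsub g A) *m invmx (mxsub f g A).
have Axhat_i : (A *m xhat) i 0 = (p *m subvec hI b) 0 0.
  by rewrite Axhat /p -!row_mul [RHS]mxE.
have subE d (v w : 'cV[R]_d) k : (v - w) k 0 = v k 0 - w k 0 by rewrite !mxE.
case: (boolP (i \in I)) => iI.
  have [l il] := set_indexP hI iI.
  suff -> : (A *m xhat - b) i 0 = 0 by rewrite normr0; apply: addr_ge0.
  rewrite subE Axhat_i.
  (* For [i] in [I], row [i] of [A] on the columns [J] is a row of the inverted block, so [p] is a
     unit vector and the entry of [b] is reproduced exactly. *)
  have -> : p = row l 1%:M.
    rewrite /p -(mulmxV nonsing) row_mul; congr (_ *m _).
    by apply/rowP => k; rewrite !mxE il.
  by rewrite -row_mul mul1mx !mxE -il subrr.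
have fi k : f k != i by apply: contraNneq iI => <-; apply: set_index_in.
have bE : b = A *m xb - eps by rewrite eps_def opprB addrC subrK.
(* Substitute [b = A *m xb - eps] both in entry [i] and in [b_I]; the coefficients of [xb] combine
   to row [i] of [A] minus [p] times the rows [I], which are the Schur entries. *)
have errE : (A *m xhat - b) i 0 =
    eps i 0 - (\sum_k p 0 k * subvec hI eps k 0 + \sum_j schur_entry A f g i j * xb j 0).
  rewrite subE Axhat_i [in X in _ - X]bE.
  have -> : subvec hI b = rowsub f A *m xb - subvec hI eps.
    by rewrite mul_rowsub_mx bE; apply/colP => k; rewrite !mxE.
  have -> : \sum_j schur_entry A f g i j * xb j 0 =
      (A *m xb) i 0 - (p *m rowsub f A *m xb) 0 0.
    rewrite !mxE -sumrB; apply: eq_bigr => j _; rewrite -mulrBl; congr (_ * _).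
    by rewrite /schur_entry -/p colE mulmxA -colE [in LHS]mxE.
  by rewrite mulmxBr mulmxA !subE [(p *m subvec hI eps) 0 0]mxE; ring.
rewrite errE; apply: le_trans (ler_normB _ _) _; rewrite addrC lerD //; last first.
  have iI' : i \in ~: I by rewrite inE.
  have [k ik] := set_indexP (erefl #|~: I|) iI'.
  by apply: le_trans (le_norm_inf _ k); rewrite mxE -ik.
(* The coefficients [p] are at most 1, which leaves the 1-norm of [eps_I]; the Schur entries are
   bounded uniformly, which leaves that of [xb]. *)
apply: le_trans (ler_normD _ _) _; apply: lerD.
  apply: le_trans (ler_norm_sum _ _ _) _; apply: ler_sum => k _.
  by rewrite normrM ler_piMl // maxvol_coef_le1.
apply: le_trans (ler_norm_sum _ _ _) _; rewrite mulr_sumr; apply: ler_sum => j _.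
rewrite normrM ler_wpM2r //.
case: (boolP (j \in J)) => [jJ|jJ].
  have [l ->] := set_indexP hJ jJ.
  by rewrite schur_entry_col // normr0 skeleton_bound_ge0.
apply: schur_entry_le => // k.
by apply: contraNneq jJ => <-; apply: set_index_in.
Qed.
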